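(* For all $1\le p<q<\infty$ there are constants $c=c(p,q)>0$, $C=C(p,q)>0$ and $T=T(p,q)>0$, not depending on $n$, such that if $\nu=\nu_{p,n}$ denotes the normalized Lebesgue measure on the ball of $L_p^n$ then, for all $n$ large enough, $$\nu(\|u\|_{L_q^n}>t)\le \exp(-c\,t^p n^{p/q})\qquad\text{for all } t>T,\tag{1}$$ and $$\nu(\|u\|_{L_q^n}>t)\ge \exp(-C\,t^p n^{p/q})\qquad\text{for all } 2\le t\le \tfrac12 n^{\frac1p-\frac1q}.\tag{2}$$ Moreover, there are universal constants $\gamma,\Gamma,\tau>0$ such that for all $1\le p<q<\infty$ with $q>2p$, for all $n$ large enough, the inequalities (1) and (2) hold, in the stated ranges of $t$, with $c=\gamma/p$, $C=\Gamma/p$ and $T=\tau\min\{q,\log n\}^{1/p}$ (so that $T\le\tau q^{1/p}$). The same holds with the condition $q>2p$ replaced by $q>\lambda p$ for any fixed $\lambda>1$, with $\gamma,\Gamma,\tau$ then depending only on $\lambda$.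
   Context: For $0<r<\infty$ and $u=(u_1,\dots,u_n)\in\mathbb{R}^n$, $\|u\|_{L_r^n}=\bigl(n^{-1}\sum_{i=1}^n|u_i|^r\bigr)^{1/r}$. The ball of $L_p^n$ is $B_{p,n}=\{u\in\mathbb{R}^n: n^{-1}\sum_{i=1}^n|u_i|^p\le 1\}$, and $\nu$ is Lebesgue measure on $B_{p,n}$ normalized to be a probability measure. $\nu(\|u\|_{L_q^n}>t)$ abbreviates $\nu(\{u\in B_{p,n}:\|u\|_{L_q^n}>t\})$. ''For all $n$ large enough'' means for all $n\ge N$, where $N$ may depend on $p$ and $q$ (and on $\lambda$ in the last sentence) but not on $t$. *)

(* Defs.v *)
From HB Require Import structures.
From mathcomp Require Export all_boot all_order all_algebra.
From mathcomp Require Export all_classical all_reals all_analysis.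
From mathcomp Require Export measurable_realfun.

Set Implicit Arguments.
Unset Strict Implicit.
Unset Printing Implicit Defensive.

Import Order.TTheory GRing.Theory Num.Theory.
Import numFieldNormedType.Exports.

Local Open Scope classical_set_scope.
Local Open Scope ring_scope.

(* R^n is represented by n-tuples, whose sigma-algebra in the library is the
   one generated by the coordinates, i.e., here, the Borel sigma-algebra. *)
Notation Rn R n := (n.-tuple (measurableTypeR R)).

Section lebesgue_cons.
Context {R : realType} (n : nat).
Variable mu : {sigma_finite_measure set (Rn R n) -> \bar R}.

Definition tuple_cons (xu : measurableTypeR R * Rn R n) : Rn R n.+1 :=
  [the n.+1.-tuple (measurableTypeR R) of xu.1 :: xu.2].

Lemma measurable_tuple_cons : measurable_fun [set: _] tuple_cons.
Proof. exact: measurable_cons. Qed.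

Definition lebesgue_cons : set (Rn R n.+1) -> \bar R :=
  pushforward (lebesgue_measure \x mu)%E tuple_cons.

Let lebesgue_cons0 : lebesgue_cons set0 = 0%E.
Proof. by rewrite /lebesgue_cons /pushforward preimage_set0 measure0. Qed.

Let lebesgue_cons_ge0 A : (0 <= lebesgue_cons A)%E.
Proof. by rewrite /lebesgue_cons /pushforward; exact: measure_ge0. Qed.

Let lebesgue_cons_sigma_additive : semi_sigma_additive lebesgue_cons.
Proof.
move=> F mF tF mUF; rewrite /lebesgue_cons /pushforward preimage_bigcup.
apply: measure_semi_sigma_additive.
- by move=> k; rewrite -[X in measurable X]setTI; exact: measurable_tuple_cons.
- apply/trivIsetP => /= i j _ _ ij; rewrite -preimage_setI.
  by move/trivIsetP : tF => /(_ _ _ _ _ ij) ->//; rewrite preimage_set0.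
- by rewrite -preimage_bigcup -[X in measurable X]setTI;
    exact: measurable_tuple_cons.
Qed.

HB.instance Definition _ := isMeasure.Build _ _ _ lebesgue_cons
  lebesgue_cons0 lebesgue_cons_ge0 lebesgue_cons_sigma_additive.

Let lebesgue_cons_sigma_finite : sigma_finite setT lebesgue_cons.
Proof.
pose split_ (u : Rn R n.+1) : measurableTypeR R * Rn R n :=
  (thead u, [tuple of behead u]).
have msplit : measurable_fun setT split_.
  by apply/measurable_fun_pair; [exact: measurable_tnth|exact: measurable_behead].
have /sigma_finiteP[F [TF ndF Foo]] := sigma_finiteT (@lebesgue_measure R).
have /sigma_finiteP[G [TG ndG Goo]] := sigma_finiteT mu.
exists (fun k => split_ @^-1` (F k `*` G k)).
  apply/esym; rewrite -subTset => u _.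
  have [i _ Fi] : (\bigcup_k F k) (thead u) by rewrite -TF.
  have [j _ Gj] : (\bigcup_k G k) [tuple of behead u] by rewrite -TG.
  exists (maxn i j) => //; split => /=.
  - by move: Fi; exact/subsetPset/ndF/leq_maxl.
  - by move: Gj; exact/subsetPset/ndG/leq_maxr.
move=> k; have [mF Fk] := Foo k; have [mG Gk] := Goo k.
split; first by rewrite -[X in measurable X]setTI; apply: msplit => //;
  exact: measurableX.
rewrite /lebesgue_cons /pushforward -comp_preimage.
have -> : split_ \o tuple_cons = id.
  by apply/funext => -[x u]; congr (_, _); apply/val_inj.
by rewrite preimage_id product_measure1E// lte_mul_pinfty// ge0_fin_numE.
Qed.

HB.instance Definition _ := Measure_isSigmaFinite.Build _ _ _ lebesgue_cons
  lebesgue_cons_sigma_finite.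

End lebesgue_cons.

Fixpoint lebesgue_Rn {R : realType} (n : nat) :
    {sigma_finite_measure set (Rn R n) -> \bar R} :=
  match n with
  | 0 => dirac [tuple] : {sigma_finite_measure set (Rn R 0) -> \bar R}
  | n'.+1 => lebesgue_cons (lebesgue_Rn n')
  end.

Lemma lebesgue_Rn_box {R : realType} (n : nat)
    (A : 'I_n -> set (measurableTypeR R)) : (forall i, measurable (A i)) ->
  lebesgue_Rn n [set u | forall i, A i (tnth u i)] =
  (\prod_(i < n) lebesgue_measure (A i))%E.
Proof.
elim: n A => [|n IHn] A mA.
  rewrite big_ord0 /= diracE mem_set//= => -[]//.
rewrite big_ord_recl -IHn// -product_measure1E//; last first.
  rewrite [X in measurable X](_ : _ =
    \big[setI/setT]_(i < n) ((@tnth _ (measurableTypeR R))^~ i @^-1` A (lift ord0 i))).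
    apply: bigsetI_measurable => i _; rewrite -[X in measurable X]setTI.
    exact: measurable_tnth.
  apply/seteqP; split => u /=.
  - by move=> Au; rewrite -bigcap_seq => i _; exact: Au.
  - rewrite -bigcap_seq => Au i; apply: (Au i); exact: mem_index_enum.
rewrite /= /lebesgue_cons /pushforward; congr product_measure1.
apply/seteqP; split => -[x u] /=.
- by move=> Axu; split=> [|i]; [exact: (Axu ord0)|have := Axu (lift ord0 i); rewrite tnthS].
- by move=> [Ax Au] i; case: (unliftP ord0 i) => [j ->|->]; rewrite ?tnthS//; exact: Au.
Qed.

Section Lrn.
Context {R : realType}.

Definition Lrn_norm (r : R) (n : nat) (u : Rn R n) : R :=
  (n%:R^-1 * \sum_(i < n) `|tnth u i| `^ r) `^ r^-1.

Definition Lpn_ball (p : R) (n : nat) : set (Rn R n) :=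
  [set u | n%:R^-1 * \sum_(i < n) `|tnth u i| `^ p <= 1].
Arguments Lpn_ball : clear implicits.

Lemma measurable_Lpn_ball (p : R) (n : nat) : measurable (Lpn_ball p n).
Proof.
rewrite (_ : Lpn_ball p n = (fun u : Rn R n =>
   n%:R^-1 * \sum_(i < n) `|tnth u i| `^ p) @^-1` `]-oo, 1]); last first.
  by apply/seteqP; split => u /=; rewrite in_itv.
rewrite -[X in measurable X]setTI.
suff : measurable_fun [set: Rn R n]
    (fun u => n%:R^-1 * \sum_(i < n) `|tnth u i| `^ p : R) by exact.
apply: measurable_funM => //; apply: measurable_sum => i.
apply: (measurableT_comp (measurable_powR p)).
apply: measurableT_comp => //; exact: measurable_tnth.
Qed.
Arguments measurable_Lpn_ball : clear implicits.

(* The second argument of mnormalize is only used when the measure to normalize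
   has total mass 0 or +oo, which is not the case here for p > 0 and n > 0. *)
Definition nu (p : R) (n : nat) : probability (Rn R n) R :=
  mnormalize (mrestr (lebesgue_Rn n) (measurable_Lpn_ball p n))
    (dirac (nseq_tuple n 0 : Rn R n)).

Definition upper_tail (p q c T : R) (n : nat) : Prop :=
  forall t : R, T < t ->
    (nu p n [set u | (t < Lrn_norm q u)%R] <=
     (expR (- (c * t `^ p * n%:R `^ (p / q))))%:E)%E.

Definition lower_tail (p q C : R) (n : nat) : Prop :=
  forall t : R, 2 <= t -> t <= 2^-1 * n%:R `^ (p^-1 - q^-1) ->
    ((expR (- (C * t `^ p * n%:R `^ (p / q))))%:E <=
     nu p n [set u | (t < Lrn_norm q u)%R])%E.

Definition universal_T (tau p q : R) (n : nat) : R :=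
  tau * (Num.min q (ln n%:R)) `^ p^-1.

End Lrn.

(* Main.v *)
Require Import Defs.
From mathcomp Require Import all_boot all_order all_algebra.
From mathcomp Require Import all_classical all_reals all_analysis.
From mathcomp Require Import ring lra.
Set Implicit Arguments.
Unset Strict Implicit.
Unset Printing Implicit Defensive.
Import Order.TTheory GRing.Theory Num.Theory.
Import numFieldNormedType.Exports.
Local Open Scope classical_set_scope.
Local Open Scope ring_scope.

(** Write [S_r(u)] for the sum of the [|u_i|^r], [Z] for the integral of
    [exp(-|x|^p / p)] over the line and [sigma = t^p n^(p/q)]. The event
    [t < ||u||_q] is [n t^q < S_q(u)], and [sigma = s^p] where [s = t n^(1/q)] is
    the size that a single coordinate needs to cause it. A factor that is
    linear in [n], even with a constant depending on [p] and [q], is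
    negligible: [sigma >= n^(p/q)] for [t >= 1], so such a factor is
    below [exp(eps sigma)] for all large [n], uniformly in [t]
    ([linear_le_exp_powR]). Hence the uniform measure on the ball may be compared
    with the product of the weights [exp(-|x|^p / p)] at a linear cost:
    the volume [V] of the ball satisfies [Z^n e^(n/p) <= K n V]
    ([ball_volume_ge_mass]). This follows by cutting the integral [Z^n] of
    [exp(-S_p / p)] into the shells [k <= S_p < k + 1], since the volume of
    [S_p <= r] is proportional to [r^(n/p)], and
    [(r/n)^(n/p) <= e^((r - n)/p)].

    Upper bound ([volume_Lq_tail_le]). Put [theta = s^(p - q) / (2p)] and
    [g(x) = min(|x|^q, s^q)]. Truncating at level [s^q] loses nothing: if
    [S_q(u) > s^q] then the sum of the [g(u_i)] is still at least [s^q]. And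
    [theta g(x) <= |x|^p / (2p)] for every [x], so the exponential moment
    of [g] is harmless: the integral of [exp(-|x|^p / p + theta g)] is at most
    [Z exp(theta M)] with [M = 4 (4q)^(q/p)]. Markov's inequality for
    [exp(theta (sum of the g(u_i)))] gives the factor
    [exp(theta (n M - s^q)) <= exp(-theta s^q / 2) = exp(-sigma / (4p))]
    as soon as [t^q >= 2M], which holds for [t >= 32 q^(1/p)].

    Lower bound ([first_coordinate_tail_ge]). It suffices that the first
    coordinate exceeds [a = s], and it does so in the interval from [a] to
    [b = a (1 + 1/(4p))], at a cost [(1 - b^p/n)^((n-1)/p) >= exp(-4 a^p / p)]
    and a factor of order [1/n]; the range of [t] ensures [a^p <= n/2], so that
    [b^p <= 2n/3].

    The resulting constants [gamma = 1/8], [Gamma = 5], [tau = 32] are valid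
    for all [1 <= p < q], and [min(q, ln n) = q] for large [n]
    ([tails_eventually]); the three parts of the theorem are special cases. *)

(** * Dilations of the line and integration over R^n *)

Lemma lebesgue_measure_dilation (R : realType) (a : R) (A : set R) :
  0 < a -> measurable A ->
  lebesgue_measure (( *%R a) @^-1` A) = ((a^-1)%:E * lebesgue_measure A)%E.
Proof.
move=> a0 mA.
have ma : measurable_fun setT ( *%R a : _ -> measurableTypeR R).
  exact: measurable_funM.
pose m := mscale (NngNum (ltW a0)) (pushforward lebesgue_measure ( *%R a : measurableTypeR R -> measurableTypeR R)).
suff : lebesgue_measure A = m ma A.
  move=> ->; rewrite /m /mscale/= muleA -EFinM mulVf ?gt_eqF// mul1e//.
apply: lebesgue_measure_unique => //= _ [[x y]] _ <-.
rewrite /mscale/= /pushforward.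
have -> : [set` `]x, y]%R] = [set` `]x, y]%R] :> set R by [].
have -> : *%R a @^-1` `]x, y] = `](a^-1 * x), (a^-1 * y)]%classic.
  apply/seteqP; split => z /=; rewrite !in_itv/= ltr_pdivrMl// ler_pdivlMl//.
rewrite !lebesgue_measure_itv/= !lte_fin ltr_pM2l ?invr_gt0//.
by case: ifPn => // _; rewrite ?mule0// -!EFinD -EFinM -mulrBr mulrA divff ?gt_eqF// mul1r.
Qed.

Lemma ge0_integral_dilation (R : realType) (a : R) (f : R -> \bar R) :
  0 < a -> measurable_fun setT f -> (forall x, (0 <= f x)%E) ->
  (\int[lebesgue_measure]_x f (a * x)%R = (a^-1)%:E * \int[lebesgue_measure]_x f x)%E.
Proof.
move=> a0 mf f0.
have ma : measurable_fun setT ( *%R a : measurableTypeR R -> measurableTypeR R).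
  exact: measurable_funM.
have ai0 : 0 <= a^-1 by rewrite invr_ge0 ltW.
transitivity (\int[mscale (NngNum ai0) lebesgue_measure]_x f x)%E; last first.
  by rewrite ge0_integral_mscale.
rewrite -[LHS](ge0_integral_pushforward ma _ measurableT)//.
by apply: eq_measure_integral => A mA _ /=; rewrite /mscale/= -lebesgue_measure_dilation.
Qed.

Lemma measurable_tuple_cons_section {R : realType} (n : nat) (x : R) :
  measurable_fun setT (fun u : Rn R n => tuple_cons (x, u)).
Proof.
exact: measurableT_comp (@measurable_tuple_cons R n) (pair1_measurable x).
Qed.

(** Cavalieri principle: slicing along the first coordinate. *)
Lemma lebesgue_RnS {R : realType} (n : nat) (A : set (Rn R n.+1)) :
  lebesgue_Rn n.+1 A =
  (\int[lebesgue_measure]_x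
     lebesgue_Rn n [set u : Rn R n | A (tuple_cons (x, u))])%E.
Proof.
rewrite /= /lebesgue_cons /pushforward /product_measure1; apply: eq_integral => x _ /=.
by congr (lebesgue_Rn n _); apply/seteqP; split => u; rewrite /xsection/= inE.
Qed.

Lemma measurable_lebesgue_Rn_section {R : realType} (n : nat) (A : set (Rn R n.+1)) :
  measurable A ->
  measurable_fun setT
    (fun x : R => lebesgue_Rn n [set u : Rn R n | A (tuple_cons (x, u))]).
Proof.
move=> mA; have := measurable_tuple_cons measurableT mA; rewrite setTI => mcA.
apply: (eq_measurable_fun _ _ (measurable_fun_xsection (lebesgue_Rn n) mcA)).
by move=> x _ /=; congr (lebesgue_Rn n _); apply/seteqP; split => u;
  rewrite /xsection/= inE.
Qed.

Lemma ge0_integral_lebesgue_RnS {R : realType} (n : nat) (f : Rn R n.+1 -> \bar R) :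
  measurable_fun setT f -> (forall u, (0 <= f u)%E) ->
  (\int[lebesgue_Rn n.+1]_u f u =
   \int[lebesgue_measure]_x \int[lebesgue_Rn n]_u f (tuple_cons (x, u)))%E.
Proof.
move=> mf f0.
rewrite [LHS](ge0_integral_pushforward (@measurable_tuple_cons R n) _ measurableT)//.
rewrite preimage_setT fubini_tonelli1//=.
exact: measurableT_comp mf (@measurable_tuple_cons R n).
Qed.

Lemma measurable_prod_tnth {R : realType} (n : nat) (f : R -> R) :
  measurable_fun setT f ->
  measurable_fun [set: Rn R n] (fun u : Rn R n => \prod_(i < n) f (tnth u i)).
Proof.
move=> mf; apply: measurable_prod => i _.
apply: measurableT_comp mf _; exact: measurable_tnth.
Qed.

Lemma integral_lebesgue_Rn_prod {R : realType} (n : nat) (f : R -> R) (I : R) :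
  measurable_fun setT f -> (forall x, 0 <= f x) ->
  (\int[lebesgue_measure]_x (f x)%:E = I%:E)%E ->
  (\int[lebesgue_Rn n]_u (\prod_(i < n) f (tnth u i))%:E = (I ^+ n)%:E)%E.
Proof.
move=> mf f0 fI; have mprod m : measurable_fun [set: Rn R m]
    (fun u : Rn R m => (\prod_(i < m) f (tnth u i))%:E).
  by apply/measurable_EFinP; exact: measurable_prod_tnth.
have p0 m (u : Rn R m) : (0 <= (\prod_(i < m) f (tnth u i))%:E)%E.
  by rewrite lee_fin prodr_ge0.
elim: n => [|n IHn].
  rewrite (@integral_dirac _ _ [tuple] R _ measurableT _ (mprod 0%N)).
  by rewrite /= diracE mem_set// mul1e big_ord0 expr0.
rewrite ge0_integral_lebesgue_RnS; [|exact: mprod|exact: p0].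
transitivity (\int[lebesgue_measure]_x ((f x)%:E * (I ^+ n)%:E))%E.
  apply: eq_integral => x _; rewrite -IHn -ge0_integralZl//.
  - apply: eq_integral => u _; rewrite big_ord_recl/= EFinM; congr (_ * (_)%:E)%E.
    by apply: eq_bigr => i _; rewrite tnthS.
  - exact: mprod.
  - by rewrite lee_fin.
rewrite ge0_integralZr//.
- by rewrite fI -EFinM exprS.
- exact/measurable_EFinP.
- by move=> x _; rewrite lee_fin.
- by rewrite lee_fin exprn_ge0// -lee_fin -fI; apply: integral_ge0 => x _; rewrite lee_fin.
Qed.

(** * Volumes of balls *)

(** The sum [S_p(u)] of the p-th powers of the absolute values of the
    coordinates, without the normalization by [1/n]. *)
Definition power_sum {R : realType} (p : R) {n : nat} (u : Rn R n) : R :=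
  \sum_(i < n) `|tnth u i| `^ p.

(** The volume of the set [S_p(u) <= r] in dimension [n]. The radius is given by
    its p-th power [r], so that [Lpn_ball p n] has volume [ball_volume p n n%:R];
    the volume is 0 for [r < 0]. *)
Definition ball_volume {R : realType} (p : R) (n : nat) (r : R) : \bar R :=
  lebesgue_Rn n [set u : Rn R n | power_sum p u <= r].

Lemma measurable_power_sum {R : realType} (p : R) (n : nat) :
  measurable_fun setT (@power_sum R p n).
Proof.
apply: measurable_sum => i; apply: (measurableT_comp (measurable_powR p)).
by apply: measurableT_comp => //; exact: measurable_tnth.
Qed.

Lemma measurable_power_sum_le {R : realType} (p : R) (n : nat) (r : R) :
  measurable [set u : Rn R n | power_sum p u <= r].
Proof.
rewrite (_ : [set u | _] = power_sum p @^-1` `]-oo, r]); last first.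
  by apply/seteqP; split => u /=; rewrite in_itv.
rewrite -[X in measurable X]setTI; apply: measurable_power_sum => //.
Qed.

Lemma measurable_ball_Lq_tail {R : realType} (p q r c : R) (n : nat) :
  measurable [set u : Rn R n | power_sum p u <= r /\ c < power_sum q u].
Proof.
rewrite (_ : [set u | _] = [set u | power_sum p u <= r] `&`
    (~` [set u | power_sum q u <= c])).
  apply: measurableI; first exact: measurable_power_sum_le.
  by apply: measurableC; exact: measurable_power_sum_le.
by apply/seteqP; split=> u /= [? h]; split=> //; move: h; rewrite ltNge => /negP.
Qed.

Lemma measurable_ball_first_coordinate {R : realType} (p r a : R) (n : nat) :
  measurable [set u : Rn R n.+1 | power_sum p u <= r /\ a < tnth u ord0].
Proof.
apply: measurableI; first exact: measurable_power_sum_le.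
have mI : measurable (`]a, +oo[ : set (measurableTypeR R)) by exact: measurable_itv.
have := @measurable_tnth _ (measurableTypeR R) n.+1 ord0 measurableT _ mI.
rewrite setTI; congr measurable.
by apply/seteqP; split => u /=; rewrite in_itv/= andbT.
Qed.

Lemma power_sum_ge0 {R : realType} (p : R) (n : nat) (u : Rn R n) :
  0 <= power_sum p u.
Proof. by apply: sumr_ge0 => i _; exact: powR_ge0. Qed.

Lemma power_sum_cons {R : realType} (p : R) (n : nat) (x : R) (u : Rn R n) :
  power_sum p (tuple_cons (x, u)) = `|x| `^ p + power_sum p u.
Proof.
rewrite /power_sum big_ord_recl; congr (_ + _).
by apply: eq_bigr => i _; rewrite tnthS.
Qed.

Lemma ball_volumeS {R : realType} (p : R) (n : nat) (r : R) :
  ball_volume p n.+1 r =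
  (\int[lebesgue_measure]_x ball_volume p n (r - `|x| `^ p)%R)%E.
Proof.
rewrite /ball_volume lebesgue_RnS; apply: eq_integral => x _.
congr (lebesgue_Rn n _); apply/seteqP; split => u /=;
  by rewrite power_sum_cons lerBrDl.
Qed.

Lemma measurable_ball_volume_section {R : realType} (p : R) (n : nat) (r : R) :
  measurable_fun setT (fun x : R => ball_volume p n (r - `|x| `^ p)).
Proof.
have := measurable_lebesgue_Rn_section (@measurable_power_sum_le R p n.+1 r).
apply: eq_measurable_fun => x _; congr (lebesgue_Rn n _).
by apply/seteqP; split => u /=; rewrite power_sum_cons lerBrDl.
Qed.

(** Homogeneity, by induction on the dimension through [ball_volumeS]. *)
Lemma ball_volume_dilation {R : realType} (p a : R) (n : nat) (r : R) :
  0 < a -> ball_volume p n (a `^ p * r) = ((a ^+ n)%:E * ball_volume p n r)%E.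
Proof.
move=> a0; elim: n r => [|n IHn] r.
  rewrite expr0 mul1e /ball_volume /= !diracE.
  by congr (_%:R%:E); congr nat_of_bool; apply/idP/idP; rewrite !inE/= /power_sum big_ord0
    pmulr_rge0// powR_gt0.
rewrite !ball_volumeS.
pose f (x : R) := ball_volume p n (a `^ p * r - `|x| `^ p).
have /= fa := ge0_integral_dilation (f := f) a0 (measurable_ball_volume_section _ _ _)
  (fun _ => measure_ge0 _ _).
transitivity (a%:E * (a^-1%:E * \int[lebesgue_measure]_x f x))%E.
  by rewrite muleA -EFinM divff ?gt_eqF// mul1e.
rewrite -fa.
rewrite exprS EFinM -muleA; congr (_ * _)%E.
rewrite -ge0_integralZl//; last 2 first.
- exact: measurable_ball_volume_section.
- by rewrite lee_fin exprn_ge0// ltW.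
apply: eq_integral => x _; rewrite -IHn; congr ball_volume.
by rewrite normrM (gtr0_norm a0) powRM ?(ltW a0)// mulrBr.
Qed.

Lemma le_ball_volume {R : realType} (p : R) (n : nat) (r s : R) : r <= s ->
  (ball_volume p n r <= ball_volume p n s)%E.
Proof.
move=> rs; apply: le_measure; rewrite ?inE; try exact: measurable_power_sum_le.
by move=> u /= /le_trans; apply.
Qed.

Lemma ball_volume_lt0 {R : realType} (p : R) (n : nat) (r : R) : r < 0 ->
  ball_volume p n r = 0%E.
Proof.
move=> r0; rewrite /ball_volume (_ : [set u | _] = set0) ?measure0//.
apply/seteqP; split => u //= ur.
by have := le_lt_trans ur r0; rewrite ltNge power_sum_ge0.
Qed.

(** * The weight exp(-c |x|^p) *)

Lemma measurable_norm_powR {R : realType} (p : R) :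
  measurable_fun setT (fun x : R => `|x| `^ p).
Proof. exact: (measurableT_comp (measurable_powR p)). Qed.

Lemma measurable_exp_weight {R : realType} (p c : R) :
  measurable_fun setT (fun x : R => expR (- (c * `|x| `^ p))).
Proof.
apply: measurableT_comp => //; apply: measurableT_comp => //.
apply: measurable_funM => //; exact: measurable_norm_powR.
Qed.

Lemma normrB1_le_powR {R : realType} (p x : R) : 1 <= p -> `|x| - 1 <= `|x| `^ p.
Proof.
move=> p1; have [x1|x1] := leP 1 `|x|.
  by rewrite (le_trans _ (le1r_powR x1 p1))// lerBlDr lerDl.
by rewrite (le_trans _ (powR_ge0 _ _))// subr_le0 ltW.
Qed.

Lemma integral_exp_norm {R : realType} (c : R) : 0 < c ->
  (\int[lebesgue_measure]_x (expR (- (c * `|x|)))%:E = (2 / c)%:E)%E.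
Proof.
move=> c0; rewrite ge0_symfun_integralT.
- rewrite EFinM; congr (_ * _)%E; rewrite -set_itvcy.
  rewrite -[RHS]mule1 -(integral_exponential_pdf c0).
  rewrite -ge0_integralZl//=; last 3 first.
  + by apply/measurable_EFinP; exact: measurable_exponential_pdf.
  + by move=> x _; rewrite lee_fin exponential_pdf_ge0// ltW.
  + by rewrite lee_fin invr_ge0 ltW.
  rewrite integral_mkcond; apply: eq_integral => x _; rewrite patchE.
  case: ifPn => [|x0].
    rewrite inE/= in_itv/= andbT => x0; rewrite exponential_pdfE// -EFinM mulrA.
    by rewrite mulVf ?gt_eqF// mul1r mulNr ger0_norm.
  rewrite /exponential_pdf patchE (negbTE x0) mule0//.
- by move=> x; exact: expR_ge0.
- move=> x; apply: continuous_comp; last exact: continuous_expR.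
  apply: (@continuousN _ R^o); apply: (@continuousM _ R^o) => //; first exact: cst_continuous.
  exact: norm_continuous.
- by move=> x /=; rewrite normrN.
Qed.

(** The integral of [exp(-c |x|^p)] over the real line; it is finite for
    [1 <= p] and [0 < c] ([exp_massE]). *)
Definition exp_mass {R : realType} (p c : R) : R :=
  fine (\int[lebesgue_measure]_x (expR (- (c * `|x| `^ p)))%:E)%E.

(** Integrability follows from [|x|^p >= |x| - 1], by comparison with
    [e^c exp(-c |x|)]. *)
Lemma exp_massE {R : realType} (p c : R) : 1 <= p -> 0 < c ->
  (\int[lebesgue_measure]_x (expR (- (c * `|x| `^ p)))%:E = (exp_mass p c)%:E)%E.
Proof.
move=> p1 c0; rewrite fineK// ge0_fin_numE; last first.
  by apply: integral_ge0 => x _; rewrite lee_fin expR_ge0.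
apply: (@le_lt_trans _ _
    (\int[lebesgue_measure]_x ((expR c)%:E * (expR (- (c * `|x|)))%:E))%E).
  apply: ge0_le_integral => //.
  - by apply/measurable_EFinP; exact: measurable_exp_weight.
  - apply/measurable_EFinP/measurable_funM => //.
    by apply: measurableT_comp => //; apply: measurableT_comp => //; exact: measurable_funM.
  - move=> x _; rewrite -EFinM lee_fin -expRD ler_expR.
    have := ler_wpM2l (ltW c0) (normrB1_le_powR x p1); lra.
rewrite ge0_integralZl ?integral_exp_norm//.
- by rewrite -EFinM ltry.
- apply/measurable_EFinP.
  by apply: measurableT_comp => //; apply: measurableT_comp => //; exact: measurable_funM.
Qed.

Lemma exp_mass_gt0 {R : realType} (p c : R) : 1 <= p -> 0 < c -> 0 < exp_mass p c.
Proof.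
move=> p1 c0; rewrite -lte_fin -exp_massE//.
apply: (@lt_le_trans _ _ (expR (- c))%:E); first by rewrite lte_fin expR_gt0.
apply: (@le_trans _ _ (\int[lebesgue_measure]_(x in `[0%R, 1%R]) (expR (- c))%:E)%E).
  by rewrite integral_cst//= lebesgue_measure_itv/= lte_fin ltr01 oppr0 adde0 mule1.
apply: (@le_trans _ _ (\int[lebesgue_measure]_(x in `[0%R, 1%R])
   (expR (- (c * `|x| `^ p)))%:E)%E).
  apply: ge0_le_integral => //.
  - apply/measurable_EFinP/measurable_funTS; exact: measurable_exp_weight.
  - move=> x /=; rewrite in_itv/= => /andP[x0 x1].
    rewrite lee_fin ler_expR lerN2 -[leRHS]mulr1 ler_pM2l// ger0_norm//.
    rewrite -[leRHS](congr1 (@^~ p) (@powR1 R)); apply: ge0_ler_powR; rewrite ?nnegrE//; lra.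
apply: ge0_subset_integral => //.
- apply/measurable_EFinP; exact: measurable_exp_weight.
Qed.

Lemma exp_mass_dilation {R : realType} (p c a : R) : 1 <= p -> 0 < c -> 0 < a ->
  exp_mass p (c * a `^ p) = a^-1 * exp_mass p c.
Proof.
move=> p1 c0 a0; apply: EFin_inj; rewrite EFinM.
have ca0 : 0 < c * a `^ p by rewrite mulr_gt0// powR_gt0.
rewrite -(exp_massE p1 ca0) -(exp_massE p1 c0).
pose f (x : R) := (expR (- (c * `|x| `^ p)))%:E.
have f0 x : (0 <= f x)%E by rewrite lee_fin expR_ge0.
have mf : measurable_fun setT f.
  by apply/measurable_EFinP; exact: measurable_exp_weight.
rewrite -[RHS](ge0_integral_dilation a0 mf f0).
apply: eq_integral => x _; rewrite /f normrM (gtr0_norm a0) powRM ?(ltW a0)//.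
by rewrite mulrA.
Qed.

(** * Comparison of the ball with the product weight *)

(** Markov inequality for a product weight: a set on which
    [K f(u_1) ... f(u_n) >= 1] has volume at most [K I^n], where [I] is the
    integral of [f]. *)
Lemma lebesgue_Rn_le_prod {R : realType} (n : nat) (A : set (Rn R n)) (f : R -> R)
    (I K : R) :
  measurable A -> measurable_fun setT f -> (forall x, 0 <= f x) -> 0 <= K ->
  (\int[lebesgue_measure]_x (f x)%:E = I%:E)%E ->
  (forall u, A u -> 1 <= K * \prod_(i < n) f (tnth u i)) ->
  (lebesgue_Rn n A <= (K * I ^+ n)%:E)%E.
Proof.
move=> mA mf f0 K0 fI Af.
have mp := measurable_prod_tnth (n := n) mf.
have p0 (u : Rn R n) : 0 <= \prod_(i < n) f (tnth u i) by rewrite prodr_ge0.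
rewrite EFinM -(integral_lebesgue_Rn_prod n mf f0 fI) -ge0_integralZl//; last 2 first.
  exact/measurable_EFinP.
  by move=> u _; rewrite lee_fin.
rewrite -[leLHS]mul1e -integral_cst//.
apply: (@le_trans _ _ (\int[lebesgue_Rn n]_(u in A) (K%:E * (\prod_(i < n) f (tnth u i))%:E))%E).
  apply: ge0_le_integral => //.
  - apply/measurable_EFinP/measurable_funM => //; exact: measurable_funTS.
apply: ge0_subset_integral => //.
- by apply/measurable_EFinP; exact: measurable_funM.
- by move=> u _; rewrite lee_fin mulr_ge0.
Qed.

Lemma expR_power_sum {R : realType} (p c : R) (n : nat) (u : Rn R n) :
  expR (- (c * power_sum p u)) = \prod_(i < n) expR (- (c * `|tnth u i| `^ p)).
Proof. by rewrite -expR_sum sumrN -mulr_sumr. Qed.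

Lemma integral_exp_power_sum {R : realType} (p c : R) (n : nat) :
  1 <= p -> 0 < c ->
  (\int[lebesgue_Rn n]_u (expR (- (c * power_sum p u)))%:E =
   (exp_mass p c ^+ n)%:E)%E.
Proof.
move=> p1 c0; under eq_integral do rewrite expR_power_sum.
apply: (integral_lebesgue_Rn_prod n (f := fun x => expR (- (c * `|x| `^ p)))).
- exact: measurable_exp_weight.
- by move=> x; exact: expR_ge0.
- exact: exp_massE.
Qed.

Lemma ball_volume_fin_num {R : realType} (p r : R) (n : nat) :
  1 <= p -> ball_volume p n r \is a fin_num.
Proof.
move=> p1; rewrite ge0_fin_numE ?measure_ge0//.
apply: (@le_lt_trans _ _ (expR r * exp_mass p 1 ^+ n)%:E); last by rewrite ltry.
apply: (lebesgue_Rn_le_prod (f := fun x => expR (- (1 * `|x| `^ p)))).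
- exact: measurable_power_sum_le.
- exact: measurable_exp_weight.
- by move=> x; exact: expR_ge0.
- exact: expR_ge0.
- exact: exp_massE.
- by move=> u /= ur; rewrite -expR_power_sum -expRD -[leLHS]expR0 ler_expR mul1r subr_ge0.
Qed.

(** Consequence of the homogeneity: the volume is [(r/n)^(n/p)] times the volume
    for [r = n], and [x <= e^(x-1)]. *)
Lemma ball_volume_growth {R : realType} (p r : R) (n : nat) :
  1 <= p -> (0 < n)%N -> 0 < r ->
  (ball_volume p n r <= (expR ((r - n%:R) / p))%:E * ball_volume p n n%:R)%E.
Proof.
move=> p1 n0 r0; have nR : 0 < n%:R :> R by rewrite ltr0n.
have p0 : 0 < p by rewrite (lt_le_trans _ p1).
pose a := (r / n%:R) `^ p^-1.
have a0 : 0 < a by rewrite powR_gt0// divr_gt0.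
(* [a] is the dilation factor from the ball [S_p <= n] to [S_p <= r] *)
have -> : ball_volume p n r = ((a ^+ n)%:E * ball_volume p n n%:R)%E.
  rewrite -ball_volume_dilation//; congr ball_volume.
  by rewrite -powRrM mulVf ?gt_eqF// powRr1 ?divr_ge0 ?ltW// divfK ?gt_eqF.
rewrite lee_wpmul2r ?measure_ge0// lee_fin.
have -> : (r - n%:R) / p = n%:R * ((r / n%:R - 1) / p) by field; rewrite !gt_eqF.
rewrite expRM_natl lerXn2r ?nnegrE ?expR_ge0 ?(ltW a0)// expRM.
apply: ge0_ler_powR; rewrite ?nnegrE ?invr_ge0 ?expR_ge0 ?divr_ge0 ?(ltW nR) ?(ltW r0) ?(ltW p0)//.
by have := expR_ge1Dx (r / n%:R - 1); lra.
Qed.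

(** Decomposition of [exp(-c s)] according to the shell [k <= s < k + 1]; beyond
    level [L], half of the exponent is given up. *)
Lemma expRN_le_shells {R : realType} (c s : R) (L : nat) : 0 <= c -> 0 <= s ->
  expR (- (c * s)) <=
  \sum_(k < L) expR (- (c * k%:R)) * (s <= k.+1%:R)%R%:R
  + expR (- (c / 2 * L%:R)) * expR (- (c / 2 * s)).
Proof.
move=> c0 s0.
have sum_ge0 : 0 <= \sum_(k < L) expR (- (c * k%:R)) * (s <= k.+1%:R)%R%:R.
  by apply: sumr_ge0 => k _; rewrite mulr_ge0 ?expR_ge0.
have [Ls|sL] := leP L%:R s.
  rewrite -[leLHS]add0r lerD// -expRD ler_expR.
  have := ler_wpM2l c0 Ls; lra.
have /andP[ks sk] := truncn_itv s0.
have kL : (Num.truncn s < L)%N by rewrite -(ltr_nat R) (le_lt_trans ks).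
rewrite -[leLHS]addr0 lerD//.
rewrite (bigD1 (Ordinal kL))//= (ltW sk) mulr1 -[leLHS]addr0 lerD//.
  by rewrite ler_expR lerN2 ler_wpM2l.
by apply: sumr_ge0 => k _; rewrite mulr_ge0 ?expR_ge0.
Qed.

(** Integrated form of [expRN_le_shells], for [s = S_p(u)]. *)
Lemma exp_mass_le_shells {R : realType} (p c : R) (n L : nat) :
  1 <= p -> 0 < c ->
  ((exp_mass p c ^+ n)%:E <=
   \sum_(k < L) (expR (- (c * k%:R)))%:E * ball_volume p n k.+1%:R
   + (expR (- (c / 2 * L%:R)) * exp_mass p (c / 2) ^+ n)%:E)%E.
Proof.
move=> p1 c0; have c20 : 0 < c / 2 by rewrite divr_gt0.
pose A k := [set u : Rn R n | power_sum p u <= k.+1%:R].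
have mA k : measurable (A k) by exact: measurable_power_sum_le.
have mexp b : measurable_fun setT (fun u : Rn R n => expR (- (b * power_sum p u))).
  apply: measurableT_comp => //; apply: measurableT_comp => //.
  by apply: measurable_funM => //; exact: measurable_power_sum.
have mshell k : measurable_fun setT
    (fun u : Rn R n => (expR (- (c * k%:R)) * \1_(A k) u)%:E).
  by apply/measurable_EFinP; apply: measurable_funM.
rewrite -integral_exp_power_sum// EFinM -integral_exp_power_sum//.
rewrite -ge0_integralZl//; last first.
- by apply/measurable_EFinP.
have -> : (\sum_(k < L) (expR (- (c * k%:R)))%:E * ball_volume p n k.+1%:R =
    \int[lebesgue_Rn n]_u \sum_(k < L) (expR (- (c * k%:R)) * \1_(A k) u)%:E)%E.
  rewrite ge0_integral_sum//.
  apply: eq_bigr => k _; under eq_integral do rewrite EFinM.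
  rewrite ge0_integralZl//; last first.
  - by apply/measurable_EFinP.
  by rewrite integral_indic// setIT.
have sum0 (u : Rn R n) : (0 <= \sum_(k < L) (expR (- (c * k%:R)) * \1_(A k) u)%:E)%E.
  by apply: sume_ge0 => k _; rewrite lee_fin mulr_ge0 ?expR_ge0.
have msum : measurable_fun setT
    (fun u : Rn R n => \sum_(k < L) (expR (- (c * k%:R)) * \1_(A k) u)%:E)%E.
  by apply: emeasurable_sum.
have mtail : measurable_fun setT (fun u : Rn R n => ((expR (- (c / 2 * L%:R)))%:E *
    (expR (- (c / 2 * power_sum p u)))%:E)%E).
  by apply/measurable_EFinP; exact: measurable_funM.
rewrite -ge0_integralD//.
apply: ge0_le_integral => //.
- by apply/measurable_EFinP.
- exact: emeasurable_funD.
move=> u _; rewrite sumEFin -EFinM -EFinD lee_fin.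
rewrite (le_trans (expRN_le_shells L (ltW c0) (power_sum_ge0 p u)))// lerD2r.
apply: ler_sum => k _; rewrite indicE.
have -> // : (u \in A k) = (power_sum p u <= k.+1%:R).
by apply/idP/idP; rewrite inE.
Qed.

(** Up to a factor linear in [n], the volume of the ball of [L_p^n] is at least
    the bound [Z^n e^(n/p)] that Markov inequality gives from above. *)
Lemma ball_volume_ge_mass {R : realType} (p : R) : 1 <= p ->
  exists2 K : R, 0 < K & forall n : nat, (0 < n)%N ->
    exp_mass p p^-1 ^+ n * expR (n%:R / p)
      <= K * n%:R * fine (ball_volume p n n%:R).
Proof.
move=> p1; have p0 : 0 < p by rewrite (lt_le_trans _ p1).
have c0 : 0 < p^-1 by rewrite invr_gt0.
have c20 : 0 < p^-1 / 2 by rewrite divr_gt0.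
set Z := exp_mass p p^-1; have Z0 : 0 < Z by exact: exp_mass_gt0.
set Z2 := exp_mass p (p^-1 / 2); have Z20 : 0 < Z2 by exact: exp_mass_gt0.
(* [K] shells per dimension, enough for the part beyond [K n] to be at most
   [(Z/2)^n] *)
pose K := (Num.truncn (2 * Z2 / Z * (2 * p))).+1.
have KP : expR (- (p^-1 / 2 * K%:R)) * Z2 <= Z / 2.
  have : 2 * Z2 / Z <= p^-1 / 2 * K%:R.
    have : 2 * Z2 / Z * (2 * p) < K%:R by exact: truncnS_gt.
    rewrite -ltr_pdivlMr ?mulr_gt0// => /ltW /le_trans; apply.
    by rewrite mulrC -invfM [2 * p]mulrC.
  set b := p^-1 / 2 * K%:R => bZ.
  have : 2 * Z2 / Z <= expR b by have := expR_ge1Dx b; lra.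
  rewrite (ler_pdivrMr _ _ Z0) => h.
  rewrite expRN mulrC (ler_pdivrMr _ _ (expR_gt0 b)); lra.
exists (2 * K%:R * expR p^-1); first by rewrite !mulr_gt0 ?expR_gt0// ltr0n.
move=> n n0; set V := ball_volume p n n%:R.
have VE : V = (fine V)%:E by rewrite fineK// ball_volume_fin_num.
have := exp_mass_le_shells n (K * n)%N p1 c0.
rewrite -/Z -/Z2 => h.
have {h} : ((Z ^+ n)%:E <=
  ((K * n)%:R * expR ((1 - n%:R) / p))%:E * (fine V)%:E + ((Z / 2) ^+ n)%:E)%E.
  apply: (le_trans h); apply: leeD.
    apply: (@le_trans _ _ (\sum_(k < K * n) (expR ((1 - n%:R) / p))%:E * (fine V)%:E)%E).
      apply: lee_sum => k _.
      apply: (@le_trans _ _ ((expR (- (p^-1 * k%:R)))%:E *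
          ((expR ((k.+1%:R - n%:R) / p))%:E * V))%E).
        by apply: lee_wpmul2l; rewrite ?lee_fin ?expR_ge0// ball_volume_growth.
      rewrite muleA -EFinM -expRD -VE.
      have -> // : - (p^-1 * k%:R) + (k.+1%:R - n%:R) / p = (1 - n%:R) / p.
      by rewrite -natr1; field; rewrite gt_eqF.
    under eq_bigr do rewrite -EFinM.
    by rewrite sumEFin -EFinM lee_fin sumr_const card_ord -[leLHS]mulr_natl mulrA.
  rewrite lee_fin natrM mulrA -mulNr expRM_natr -exprMn lerXn2r// nnegrE.
    by rewrite mulr_ge0 ?expR_ge0 ?(ltW Z20).
  by rewrite divr_ge0 ?(ltW Z0).
rewrite -EFinM -EFinD lee_fin => h.
have Zn : (Z / 2) ^+ n <= Z ^+ n / 2.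
  rewrite expr_div_n ler_wpM2l ?exprn_ge0 ?(ltW Z0)//.
  rewrite lef_pV2 ?posrE ?exprn_gt0// -[leLHS]expr1 ler_weXn2l//; lra.
have {h Zn} h : Z ^+ n <= 2 * (K * n)%:R * expR ((1 - n%:R) / p) * fine V by lra.
apply: (le_trans (ler_wpM2r (expR_ge0 _) h)).
have -> : expR ((1 - n%:R) / p) = expR p^-1 / expR (n%:R / p).
  by rewrite mulrBl mul1r expRB.
have : expR (n%:R / p) != 0 by rewrite gt_eqF// expR_gt0.
rewrite natrM; set E := expR (n%:R / p) => E0; rewrite le_eqVlt; apply/orP; left.
by apply/eqP; field.
Qed.

(** * Exponential moments of truncated q-th powers *)

Lemma powR_expR_bound {R : realType} (p q x : R) : 0 < p -> 0 < q -> 0 <= x ->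
  x `^ q * expR (- ((4 * p)^-1 * x `^ p)) <= (4 * q) `^ (q / p).
Proof.
move=> p0 q0 x0; set y := x `^ p; have y0 : 0 <= y by exact: powR_ge0.
have q4 : 0 < 4 * q by rewrite mulr_gt0.
have -> : x `^ q = y `^ (q / p).
  by rewrite /y -powRrM mulrCA divff ?gt_eqF// mulr1.
have -> : - ((4 * p)^-1 * y) = - (y / (4 * q)) * (q / p).
  by field; rewrite !gt_eqF.
rewrite expRM -powRM ?expR_ge0//.
apply: ge0_ler_powR; rewrite ?nnegrE ?divr_ge0 ?mulr_ge0 ?expR_ge0 ?(ltW p0) ?(ltW q0)//.
rewrite expRN ler_pdivrMr ?expR_gt0// -ler_pdivrMl// mulrC.
by have := expR_ge1Dx (y / (4 * q)); lra.
Qed.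

(** With [theta = s^(p-q) / (2p)], the tilt [theta min(x^q, s^q)] takes up at
    most half of the exponent [x^p / p]: there is equality at [x = s], below [s]
    the tilt decays faster because [q > p], and above [s] it is constant. *)
Lemma truncated_tilt {R : realType} (p q s x : R) :
  0 < p -> p < q -> 0 < s -> 0 <= x ->
  s `^ p / (2 * p * s `^ q) * Num.min (x `^ q) (s `^ q) <= (2 * p)^-1 * x `^ p.
Proof.
move=> p0 pq s0 x0; have sq0 : 0 < s `^ q by rewrite powR_gt0.
have sp0 : 0 < s `^ p by rewrite powR_gt0.
have -> : s `^ p / (2 * p * s `^ q) = (2 * p)^-1 * (s `^ p / s `^ q).
  by field; rewrite !gt_eqF.
rewrite -mulrA ler_pM2l ?invr_gt0 ?mulr_gt0//.
have [xs|sx] := leP x s.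
  apply: (@le_trans _ _ (s `^ p / s `^ q * x `^ q)).
    by rewrite ler_wpM2l ?ge_min ?lexx// divr_ge0 ?powR_ge0.
  have splitq y : 0 <= y -> y `^ q = y `^ p * y `^ (q - p).
    by move=> y0; rewrite -powRD ?subrKC// gt_eqF// (lt_trans p0).
  have sqp : 0 < s `^ (q - p) by rewrite powR_gt0.
  have -> : s `^ p / s `^ q * x `^ q = x `^ p * (x `^ (q - p) / s `^ (q - p)).
    by rewrite !splitq ?(ltW s0)//; field; rewrite !gt_eqF.
  rewrite -[leRHS]mulr1 ler_wpM2l ?powR_ge0// ler_pdivrMr// mul1r.
  by apply: ge0_ler_powR; rewrite ?nnegrE ?(ltW s0)// subr_ge0 ltW.
apply: (@le_trans _ _ (s `^ p / s `^ q * s `^ q)).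
  by rewrite ler_wpM2l ?ge_min ?lexx ?orbT// divr_ge0 ?powR_ge0.
rewrite divfK ?gt_eqF//.
by apply: ge0_ler_powR; rewrite ?nnegrE ?(ltW s0) ?(ltW p0)// ltW.
Qed.

(** For [theta = s^(p-q) / (2p)], a majorant of
    [exp(-|x|^p / p + theta min(|x|^q, s^q))] whose integral is explicit; see [tilted_weight_ge] and [integral_tilted_weight]. *)
Definition tilted_weight {R : realType} (p q theta x : R) : R :=
  expR (- (p^-1 * `|x| `^ p)) +
  theta * (4 * q) `^ (q / p) * expR (- (p^-1 / 4 * `|x| `^ p)).

(** Since [e^v <= 1 + v e^v], the tilt [e^(theta g)] costs at most
    [theta g e^(theta g)]; half of the exponent [|x|^p / p] pays for
    [e^(theta g)] and a quarter of it for [|x|^q >= g]. *)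
Lemma tilted_weight_ge {R : realType} (p q s theta x : R) :
  0 < p -> p < q -> 0 < s -> theta = s `^ p / (2 * p * s `^ q) ->
  expR (- (p^-1 * `|x| `^ p) + theta * Num.min (`|x| `^ q) (s `^ q)) <=
  tilted_weight p q theta x.
Proof.
move=> p0 pq s0 thE; have q0 : 0 < q by exact: lt_trans pq.
have th0 : 0 <= theta by rewrite thE divr_ge0 ?mulr_ge0 ?powR_ge0// ltW.
have := truncated_tilt p0 pq s0 (normr_ge0 x); rewrite -thE.
set g := Num.min _ _; set y := `|x| `^ p => gy.
have g0 : 0 <= g by rewrite le_min !powR_ge0.
have gx : g <= `|x| `^ q by rewrite ge_min lexx.
have := powR_expR_bound p0 q0 (normr_ge0 x); rewrite -/y => xb.
rewrite /tilted_weight -/y expRD.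
have e1 : expR (theta * g) <= 1 + theta * g * expR (theta * g).
  have := expR_ge1Dx (- (theta * g)); rewrite expRN => h.
  have e0 := expR_gt0 (theta * g).
  have := ler_wpM2r (ltW e0) h; rewrite mulVf ?gt_eqF//; lra.
apply: (le_trans (ler_wpM2l (expR_ge0 _) e1)).
rewrite mulrDr mulr1 lerD2l.
apply: (@le_trans _ _ (theta * (`|x| `^ q * expR (- ((4 * p)^-1 * y))) *
   expR (- (p^-1 / 4 * y)))); last first.
  by rewrite ler_wpM2r ?expR_ge0// ler_wpM2l.
have ab : expR (- (p^-1 * y)) * expR (theta * g) <=
    expR (- ((4 * p)^-1 * y)) * expR (- (p^-1 / 4 * y)).
  by rewrite -!expRD ler_expR; move: gy; rewrite !invfM; lra.
have ab0 : 0 <= expR (- (p^-1 * y)) * expR (theta * g).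
  by rewrite mulr_ge0 ?expR_ge0.
have := ler_wpM2l th0 (ler_pM g0 ab0 gx ab); lra.
Qed.

Lemma integral_tilted_weight {R : realType} (p q theta : R) :
  1 <= p -> 0 <= theta ->
  (\int[lebesgue_measure]_x (tilted_weight p q theta x)%:E =
   (exp_mass p p^-1 * (1 + theta * (4 * q) `^ (q / p) * 4 `^ p^-1))%:E)%E.
Proof.
move=> p1 th0; have p0 : 0 < p by rewrite (lt_le_trans _ p1).
have pi0 : 0 < p^-1 by rewrite invr_gt0.
(* dilating by [4^(1/p)] turns the exponent [|x|^p / (4p)] into [|x|^p / p] *)
pose a : R := 4^-1 `^ p^-1.
have a0 : 0 < a by rewrite powR_gt0// invr_gt0.
have E4 : p^-1 / 4 = p^-1 * a `^ p.
  by rewrite /a -powRrM mulVf ?gt_eqF// powRr1// invr_ge0.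
have ai : a^-1 = 4 `^ p^-1.
  by rewrite /a -powR_inv1 ?powR_ge0// -powRrM mulrC powRrM powR_inv1 ?invr_ge0// invrK.
have mw c : measurable_fun setT (fun x : R => (expR (- (c * `|x| `^ p)))%:E).
  by apply/measurable_EFinP; exact: measurable_exp_weight.
have th40 : 0 <= theta * (4 * q) `^ (q / p) by rewrite mulr_ge0 ?powR_ge0.
under eq_integral do rewrite /tilted_weight EFinD EFinM.
rewrite ge0_integralD//; last 3 first.
- exact: mw.
- by move=> x _; rewrite mule_ge0 ?lee_fin ?expR_ge0.
- by apply: emeasurable_funM => //; exact: mw.
rewrite ge0_integralZl//; last first.
- exact: mw.
rewrite !exp_massE ?divr_gt0// E4 exp_mass_dilation// ai -EFinM -EFinD.
by congr (_%:E); ring.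
Qed.

Lemma measurable_tilted_weight {R : realType} (p q theta : R) :
  measurable_fun setT (tilted_weight p q theta).
Proof.
apply: measurable_funD; first exact: measurable_exp_weight.
by apply: measurable_funM => //; exact: measurable_exp_weight.
Qed.

(** Truncating each term of a sum at level [H] keeps the sum above [H]. *)
Lemma le_sum_truncated {R : realType} (n : nat) (a : 'I_n -> R) (H : R) :
  (forall i, 0 <= a i) -> 0 <= H -> H <= \sum_(i < n) a i ->
  H <= \sum_(i < n) Num.min (a i) H.
Proof.
move=> a0 H0 Ha; have [[i Hi]|aH] := pselect (exists i, H < a i).
  rewrite (bigD1 i)//= (min_r (ltW Hi)) lerDl sumr_ge0// => j _.
  by rewrite le_min a0.
rewrite (le_trans Ha)// ler_sum// => i _; rewrite min_l// leNgt.
by apply/negP => Hi; apply: aH; exists i.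
Qed.

(** Upper tail in terms of volumes. The threshold on [t^q] is twice the bound
    [4 (4q)^(q/p)] for the tilted moment. *)
Lemma volume_Lq_tail_le {R : realType} (p q t : R) (n : nat) :
  1 <= p -> p < q -> (0 < n)%N -> 0 < t -> 8 * (4 * q) `^ (q / p) <= t `^ q ->
  (lebesgue_Rn n [set u : Rn R n |
      (power_sum p u <= n%:R)%R /\ (n%:R * t `^ q < power_sum q u)%R] <=
   (exp_mass p p^-1 ^+ n * expR (n%:R / p)
     * expR (- (4^-1 / p * t `^ p * n%:R `^ (p / q))))%:E)%E.
Proof.
move=> p1 pq n0 t0 tq; have p0 : 0 < p by rewrite (lt_le_trans _ p1).
have q0 : 0 < q by exact: lt_trans pq.
have nR : 0 < n%:R :> R by rewrite ltr0n.
pose s := t * n%:R `^ q^-1; have s0 : 0 < s by rewrite mulr_gt0// powR_gt0.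
have sq : s `^ q = n%:R * t `^ q.
  by rewrite /s powRM ?powR_ge0 ?(ltW t0)// -powRrM mulVf ?gt_eqF// powRr1 1?mulrC// ltW.
have sp : s `^ p = t `^ p * n%:R `^ (p / q).
  by rewrite /s powRM ?powR_ge0 ?(ltW t0)// -powRrM [q^-1 * p]mulrC.
set Z := exp_mass p p^-1.
have Z0 : 0 < Z by apply: exp_mass_gt0; rewrite ?invr_gt0.
have sq0 : 0 < s `^ q by rewrite powR_gt0.
have [theta thE] : exists theta, theta = s `^ p / (2 * p * s `^ q) by eexists.
have th0 : 0 <= theta by rewrite thE divr_ge0 ?mulr_ge0 ?powR_ge0// ltW.
have thH : theta * s `^ q = s `^ p / (2 * p).
  by rewrite thE; field; rewrite !gt_eqF.
have p_neq0 : p != 0 by rewrite gt_eqF.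
have pi0 : 0 < p^-1 by rewrite invr_gt0.
apply: le_trans (lebesgue_Rn_le_prod (f := tilted_weight p q theta)
  (K := expR (n%:R / p - theta * s `^ q)) _ _ _ _ (integral_tilted_weight q p1 th0) _) _.
- exact: measurable_ball_Lq_tail.
- exact: measurable_tilted_weight.
- by move=> x; rewrite /tilted_weight addr_ge0 ?expR_ge0// !mulr_ge0 ?expR_ge0 ?powR_ge0.
- exact: expR_ge0.
- move=> u /= [up uq].
  (* on this set [n/p - S_p/p] and the tilted excess are both nonnegative *)
  apply: (@le_trans _ _ (expR (n%:R / p - theta * s `^ q) *
    \prod_(i < n) expR (- (p^-1 * `|tnth u i| `^ p)
       + theta * Num.min (`|tnth u i| `^ q) (s `^ q)))); last first.
    rewrite ler_wpM2l ?expR_ge0// ler_prod// => i _; rewrite expR_ge0/=.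
    exact: tilted_weight_ge.
  rewrite -expR_sum -expRD -[leLHS]expR0 ler_expR big_split/= sumrN -!mulr_sumr.
  have := @le_sum_truncated R n (fun i => `|tnth u i| `^ q) (s `^ q)
    (fun=> powR_ge0 _ _) (powR_ge0 _ _).
  rewrite {1}sq => /(_ (ltW uq)) /(ler_wpM2l th0).
  have := ler_wpM2l (ltW pi0) up; rewrite /power_sum; lra.
rewrite lee_fin -/Z.
have M4 : 4 `^ p^-1 <= 4 :> R.
  by apply: ler1_powR; rewrite ?invf_le1//; lra.
have Zle : Z * (1 + theta * (4 * q) `^ (q / p) * 4 `^ p^-1) <=
    Z * expR (theta * (4 * (4 * q) `^ (q / p))).
  rewrite ler_wpM2l ?(ltW Z0)// (le_trans _ (expR_ge1Dx _))// lerD2l.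
  rewrite -mulrA ler_wpM2l// mulrC ler_wpM2r// powR_ge0//.
have Zn := ler_wpM2l (expR_ge0 (n%:R / p - theta * s `^ q)) (lerXn2r n _ _ Zle).
apply: le_trans (Zn _ _) _.
- by rewrite nnegrE mulr_ge0 ?(ltW Z0)// addr_ge0// !mulr_ge0 ?powR_ge0.
- by rewrite nnegrE mulr_ge0 ?(ltW Z0)// expR_ge0.
rewrite exprMn mulrCA -mulrA ler_wpM2l ?exprn_ge0 ?(ltW Z0)//.
rewrite -expRM_natr -!expRD ler_expR -addrA lerD2l.
have nM : theta * (4 * (4 * q) `^ (q / p)) * n%:R <= theta * s `^ q / 2.
  rewrite -mulrA -[leRHS]mulrA ler_wpM2l// sq.
  have := ler_wpM2l (ltW nR) tq; lra.
have -> : 4^-1 / p * t `^ p * n%:R `^ (p / q) = theta * s `^ q / 2.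
  by rewrite thH sp; field.
lra.
Qed.

(** * The normalized measure *)

Lemma Lpn_ballE {R : realType} (p : R) (n : nat) : (0 < n)%N ->
  @Lpn_ball R p n = [set u : Rn R n | power_sum p u <= n%:R].
Proof.
move=> n0; apply/seteqP; split => u /=; rewrite /Lpn_ball /= ler_pdivrMl ?ltr0n// mulr1//.
Qed.

Lemma lt_Lrn_norm {R : realType} (q t : R) (n : nat) (u : Rn R n) :
  0 < q -> (0 < n)%N -> 0 <= t ->
  (t < Lrn_norm q u) = (n%:R * t `^ q < power_sum q u).
Proof.
move=> q0 n0 t0; rewrite -ltr_pdivlMl ?ltr0n// /Lrn_norm -/(power_sum q u).
set S := _ * power_sum q u.
have S0 : 0 <= S by rewrite mulr_ge0 ?invr_ge0// power_sum_ge0.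
apply/idP/idP => h.
  have := @gt0_ltr_powR R q q0 t (S `^ q^-1); rewrite !nnegrE t0 powR_ge0.
  by rewrite -powRrM mulVf ?gt_eqF// powRr1// => /(_ isT isT h).
have qi0 : 0 < q^-1 by rewrite invr_gt0.
have := @gt0_ltr_powR R q^-1 qi0 (t `^ q) S; rewrite !nnegrE S0 powR_ge0.
by rewrite -powRrM mulfV ?gt_eqF// powRr1// => /(_ isT isT h).
Qed.

Lemma ball_volume_gt0 {R : realType} (p : R) (n : nat) : 1 <= p -> (0 < n)%N ->
  0 < fine (ball_volume p n n%:R).
Proof.
move=> p1 n0; have [K K0 /(_ n n0)] := ball_volume_ge_mass p1.
have p0 : 0 < p by rewrite (lt_le_trans _ p1).
have Kn0 : 0 < K * n%:R by rewrite mulr_gt0// ltr0n.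
move=> /(lt_le_trans _) h; rewrite -(pmulr_rgt0 _ Kn0).
by apply: h; rewrite mulr_gt0 ?expR_gt0// exprn_gt0// exp_mass_gt0// invr_gt0.
Qed.

(** For [n > 0] and [1 <= p], the ball has a positive finite volume, so the measure
    [nu p n] is the volume in the ball divided by the volume of the ball. *)
Lemma nu_tailE {R : realType} (p q t : R) (n : nat) :
  1 <= p -> 0 < q -> (0 < n)%N -> 0 <= t ->
  nu p n [set u : Rn R n | (t < Lrn_norm q u)%R] =
  (lebesgue_Rn n [set u : Rn R n |
      (power_sum p u <= n%:R)%R /\ (n%:R * t `^ q < power_sum q u)%R] *
   (fine (ball_volume p n n%:R))^-1%:E)%E.
Proof.
move=> p1 q0 n0 t0; rewrite /nu /= /mnormalize /= /mrestr setTI Lpn_ballE//.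
rewrite -/(ball_volume p n n%:R).
have V0 := ball_volume_gt0 p1 n0.
have Vfin := ball_volume_fin_num n%:R n p1.
rewrite -(fineK Vfin) eqe gt_eqF//=; congr (lebesgue_Rn n _ * _)%E.
apply/seteqP; split => u /=; rewrite lt_Lrn_norm//; tauto.
Qed.

(** * Large first coordinate *)

(** A crude bound: the section at [x] has at most the volume of the central one,
    and is empty for [|x| > n + 1], because [|x|^p >= |x|] there. *)
Lemma ball_volumeS_le {R : realType} (p : R) (n : nat) : 1 <= p ->
  (ball_volume p n.+1 n.+1%:R <= (2 * n.+1%:R)%:E * ball_volume p n n.+1%:R)%E.
Proof.
move=> p1; have p0 : 0 < p by rewrite (lt_le_trans _ p1).
rewrite ball_volumeS.
have mitv : measurable (`[(- n.+1%:R : R), n.+1%:R] : set (measurableTypeR R)).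
  exact: measurable_itv.
have -> : (2 * n.+1%:R)%:E = lebesgue_measure `[(- n.+1%:R : R), n.+1%:R]%classic.
  rewrite lebesgue_measure_itv/= lte_fin gtrN ?ltr0n// -EFinD opprK.
  by congr (_%:E); ring.
rewrite muleC -integral_cst// integral_mkcond.
apply: ge0_le_integral => //.
- exact: measurable_ball_volume_section.
- by apply/measurable_restrict => //; exact: measurable_cst.
move=> x _; rewrite patchE; case: ifPn => xn.
  by apply: le_ball_volume; rewrite gerBl powR_ge0.
rewrite ball_volume_lt0// subr_lt0.
have nx : n.+1%:R < `|x|.
  by rewrite ltNge ler_norml; apply: contra xn => h; rewrite inE/= in_itv.
apply: (lt_le_trans nx); apply: le1r_powR => //.
by rewrite (le_trans _ (ltW nx))// ler1n.
Qed.

(** Only the slices [a < x < b] are kept, and each is replaced by the smallest one,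
    at [b]. *)
Lemma volume_first_coordinate_ge {R : realType} (p a b : R) (n : nat) :
  0 < p -> 0 <= a -> a < b -> b `^ p < n.+1%:R ->
  (((b - a) * (1 - b `^ p / n.+1%:R) `^ p^-1 ^+ n)%:E * ball_volume p n n.+1%:R <=
   lebesgue_Rn n.+1 [set u : Rn R n.+1 |
     (power_sum p u <= n.+1%:R)%R /\ (a < tnth u ord0)%R])%E.
Proof.
move=> p0 a0 ab bn.
have mA := @measurable_ball_first_coordinate R p n.+1%:R a n.
rewrite lebesgue_RnS.
have nR : 0 < n.+1%:R :> R by rewrite ltr0n.
set y := 1 - b `^ p / n.+1%:R.
have y0 : 0 < y by rewrite subr_gt0 ltr_pdivrMr// mul1r.
have yV : ((y `^ p^-1 ^+ n)%:E * ball_volume p n n.+1%:R)%E =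
    ball_volume p n (n.+1%:R - b `^ p).
  rewrite -ball_volume_dilation ?powR_gt0//; congr ball_volume.
  rewrite -powRrM mulVf ?gt_eqF// powRr1 ?(ltW y0)// /y.
  by field; rewrite gt_eqF.
rewrite EFinM -muleA yV muleC.
have -> : (b - a)%:E = lebesgue_measure `]a, b[%classic.
  by rewrite lebesgue_measure_itv/= lte_fin ab -EFinD.
rewrite -integral_cst; last exact: measurable_itv.
rewrite integral_mkcond; apply: ge0_le_integral => //.
- by move=> x _; rewrite patchE; case: ifP.
- by apply/measurable_restrict => //; exact: measurable_cst.
- exact: measurable_lebesgue_Rn_section.
move=> x _; rewrite patchE; case: ifPn => [|_]; last exact: measure_ge0.
rewrite inE /= in_itv/= => /andP[ax xb].
apply: le_measure; rewrite ?inE; first exact: measurable_power_sum_le.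
  rewrite -[X in measurable X]setTI; exact: (measurable_tuple_cons_section x measurableT mA).
move=> u /= ur; rewrite power_sum_cons; split => //.
rewrite -lerBrDl (le_trans ur)// lerD2l lerN2 ger0_norm ?(le_trans a0 (ltW ax))//.
by apply: ge0_ler_powR; rewrite ?nnegrE ?(ltW p0) ?(le_trans a0 (ltW ax)) ?(le_trans a0 (ltW ab)) ?(ltW xb).
Qed.

Lemma expRN3_le_onem {R : realType} (y : R) : 0 <= y -> y <= 2 / 3 ->
  expR (- (3 * y)) <= 1 - y.
Proof.
move=> y0 y1; rewrite expRN -[leLHS]mul1r ler_pdivrMr ?expR_gt0//.
have h := expR_ge1Dx (3 * y).
have : (1 - y) * (1 + 3 * y) <= (1 - y) * expR (3 * y) by rewrite ler_wpM2l//; lra.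
apply: le_trans; nra.
Qed.

(** Here [(1 + 1/(4p))^p <= e^(1/4) <= 4/3]. *)
Lemma powR_enlarged {R : realType} (p a : R) : 1 <= p -> 0 <= a ->
  (a * (1 + (4 * p)^-1)) `^ p <= 4 / 3 * a `^ p.
Proof.
move=> p1 a0; have p0 : 0 < p by rewrite (lt_le_trans _ p1).
have e0 : 0 <= (4 * p)^-1 by rewrite invr_ge0 mulr_ge0 ?(ltW p0).
rewrite powRM ?addr_ge0// mulrC ler_wpM2r ?powR_ge0//.
apply: (@le_trans _ _ (expR (4^-1))).
  have -> : 4^-1 = (4 * p)^-1 * p :> R by field; rewrite gt_eqF.
  rewrite expRM; apply: ge0_ler_powR; rewrite ?nnegrE ?(ltW p0) ?expR_ge0 ?addr_ge0//.
  exact: expR_ge1Dx.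
have := expR_ge1Dx (- 4^-1 : R); rewrite expRN => h.
have e1 := expR_gt0 (4^-1 : R).
have := ler_wpM2r (ltW e1) h; rewrite mulVf ?gt_eqF//; lra.
Qed.

Lemma first_coordinate_tail_ge {R : realType} (p a : R) (n : nat) :
  1 <= p -> 1 <= a -> a `^ p <= n.+1%:R / 2 ->
  (((8 * p * n.+1%:R)^-1 * expR (- (4 / p * a `^ p)) *
     fine (ball_volume p n.+1 n.+1%:R))%:E <=
   lebesgue_Rn n.+1 [set u : Rn R n.+1 |
     (power_sum p u <= n.+1%:R)%R /\ (a < tnth u ord0)%R])%E.
Proof.
move=> p1 a1 an; have p0 : 0 < p by rewrite (lt_le_trans _ p1).
have a0 : 0 < a by rewrite (lt_le_trans _ a1).
have nR : 0 < n.+1%:R :> R by rewrite ltr0n.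
pose b := a * (1 + (4 * p)^-1).
have ba : b - a = a / (4 * p) by rewrite /b; ring.
have ab : a < b by rewrite -subr_gt0 ba divr_gt0 ?mulr_gt0.
have bp : b `^ p <= 4 / 3 * a `^ p by exact: powR_enlarged (ltW a0).
have bn : b `^ p <= 2 / 3 * n.+1%:R by lra.
have bn1 : b `^ p < n.+1%:R by lra.
apply: (le_trans _ (volume_first_coordinate_ge p0 (ltW a0) ab bn1)).
set W := ball_volume p n n.+1%:R.
have WE : W = (fine W)%:E by rewrite fineK// ball_volume_fin_num.
have W0 : 0 <= fine W by rewrite -lee_fin -WE measure_ge0.
have := ball_volumeS_le n p1; rewrite -/W WE.
rewrite -(fineK (ball_volume_fin_num n.+1%:R n.+1 p1)) -EFinM lee_fin => VW.
rewrite -EFinM lee_fin /=.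
set y := b `^ p / n.+1%:R.
have yn : y * n.+1%:R = b `^ p by rewrite /y divfK// gt_eqF.
have y0 : 0 <= y by rewrite divr_ge0 ?powR_ge0.
have y23 : y <= 2 / 3 by rewrite ler_pdivrMr.
have e1 : expR (- (4 / p * a `^ p)) <= (1 - y) `^ p^-1 ^+ n.
  apply: (@le_trans _ _ (expR (- (3 * y) * p^-1) ^+ n)); last first.
    rewrite lerXn2r ?nnegrE ?powR_ge0 ?expR_ge0// expRM.
    apply: ge0_ler_powR; rewrite ?nnegrE ?invr_ge0 ?(ltW p0) ?expR_ge0//; last first.
      exact: expRN3_le_onem.
    lra.
  rewrite -expRM_natr ler_expR.
  have h : y * n%:R <= 4 / 3 * a `^ p.
    by rewrite (le_trans _ bp)// -yn ler_wpM2l// ler_nat.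
  have pi0 : 0 <= p^-1 by rewrite invr_ge0 ltW.
  have := ler_wpM2l pi0 h; lra.
have ap : (4 * p)^-1 <= b - a by rewrite ba ler_peMl// invr_ge0 mulr_ge0// ltW.
(* the volume of the ball is replaced by its upper bound [2 (n+1) W] *)
apply: (@le_trans _ _ ((8 * p * n.+1%:R)^-1 * expR (- (4 / p * a `^ p)) *
  (2 * n.+1%:R * fine W))).
  by rewrite ler_wpM2l// mulr_ge0 ?expR_ge0// invr_ge0 !mulr_ge0// ltW.
have -> : (8 * p * n.+1%:R)^-1 * expR (- (4 / p * a `^ p)) * (2 * n.+1%:R * fine W) =
   (4 * p)^-1 * expR (- (4 / p * a `^ p)) * fine W.
  by field; rewrite !gt_eqF.
by rewrite ler_wpM2r// ler_pM// ?expR_ge0// invr_ge0 mulr_ge0// ltW.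
Qed.

(** * Tail bounds for large n *)

(** Any stretched exponential in [n] eventually dominates any linear function. *)
Lemma linear_le_exp_powR {R : realType} (K c al : R) : 0 < c -> 0 < al ->
  \forall n \near \oo, K * n%:R <= expR (c * n%:R `^ al).
Proof.
move=> c0 al0.
(* the term of order [k + 1] of the exponential series is at least [D n^2] *)
pose k := Num.truncn (2 / al).
have kal : 2 <= k.+1%:R * al.
  by rewrite -ler_pdivrMr// ltW// truncnS_gt.
pose D := c ^+ k.+1 / k.+1`!%:R.
have D0 : 0 < D by rewrite divr_gt0 ?exprn_gt0// ltr0n fact_gt0.
near=> n.
have n0 : 0 < n%:R :> R by rewrite ltr0n; near: n; exact: nbhs_infty_gt.
have n1 : 1 <= n%:R :> R by rewrite ler1n -(ltr0n R).
have Kn : K / D <= n%:R by near: n; exact: nbhs_infty_ger.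
have x0 : 0 <= c * n%:R `^ al by rewrite mulr_ge0 ?powR_ge0// ltW.
apply: (le_trans _ (expR_ge1Dxn k x0)); rewrite -[leLHS]add0r lerD//.
rewrite exprMn -[(_ `^ _) ^+ _]powR_mulrn ?powR_ge0// -powRrM [al * _]mulrC mulrAC -/D.
apply: (@le_trans _ _ (D * n%:R ^+ 2)).
  by rewrite expr2 mulrA ler_wpM2r ?(ltW n0)// -ler_pdivrMl// mulrC.
by rewrite ler_wpM2l ?(ltW D0)// -powR_mulrn ?(ltW n0)// ler_powR.
Unshelve. all: by end_near. Qed.

Lemma Lq_threshold {R : realType} (p q t : R) : 1 <= p -> p < q ->
  32 * q `^ p^-1 <= t -> 8 * (4 * q) `^ (q / p) <= t `^ q.
Proof.
move=> p1 pq tq; have p0 : 0 < p by rewrite (lt_le_trans _ p1).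
have q0 : 0 < q by exact: lt_trans pq.
have q1 : 1 <= q by rewrite (le_trans p1) ?ltW.
apply: (@le_trans _ _ ((32 * q `^ p^-1) `^ q)); last first.
  apply: ge0_ler_powR; rewrite ?nnegrE ?(ltW q0)// ?(le_trans _ tq)//;
    by rewrite mulr_ge0 ?powR_ge0.
rewrite !powRM ?powR_ge0 ?(ltW q0)// -powRrM [p^-1 * q]mulrC mulrA.
rewrite ler_wpM2r ?powR_ge0//.
have -> : 32 = 8 * 4 :> R by ring.
rewrite powRM// ler_pM ?powR_ge0//; first by apply: le1r_powR => //; lra.
by apply: ler_powR; rewrite ?ler_pdivrMr ?ler_peMr ?(ltW q0)//; lra.
Qed.

Lemma upper_tail_eventually {R : realType} (p q : R) : 1 <= p -> p < q ->
  \forall n \near \oo, upper_tail p q (8^-1 / p) (32 * q `^ p^-1) n.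
Proof.
move=> p1 pq; have p0 : 0 < p by rewrite (lt_le_trans _ p1).
have q0 : 0 < q by exact: lt_trans pq.
have q1 : 1 <= q by rewrite (le_trans p1) ?ltW.
have [K K0 HK] := ball_volume_ge_mass p1.
have c0 : 0 < 8^-1 / p by rewrite divr_gt0.
have pq0 : 0 < p / q by rewrite divr_gt0.
near=> n => t Tt.
have n0 : (0 < n)%N by near: n; exact: nbhs_infty_gt.
have Kn : K * n%:R <= expR (8^-1 / p * n%:R `^ (p / q)).
  by near: n; exact: linear_le_exp_powR.
have t1 : 1 <= t.
  rewrite (le_trans _ (ltW Tt))//.
  have : 1 <= q `^ p^-1 by rewrite -[leLHS](powRr0 q) ler_powR// invr_ge0 ltW.
  lra.
have t0 : 0 < t by rewrite (lt_le_trans _ t1).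
rewrite nu_tailE ?(ltW t0)//.
have V0 := ball_volume_gt0 p1 n0.
have Vi0 : 0 <= (fine (ball_volume p n n%:R))^-1 by rewrite invr_ge0 ltW.
apply: le_trans (lee_wpmul2r _ (volume_Lq_tail_le p1 pq n0 t0 _)) _.
- by rewrite lee_fin.
- by apply: Lq_threshold => //; exact: ltW.
rewrite -EFinM lee_fin ler_pdivrMr//.
set s := t `^ p * n%:R `^ (p / q).
have ns : n%:R `^ (p / q) <= s.
  rewrite ler_peMl ?powR_ge0// -[leLHS](powRr0 t) ler_powR// ltW//.
(* half of the exponent absorbs the factor [K n] *)
have -> : 4^-1 / p * t `^ p * n%:R `^ (p / q) = 8^-1 / p * s + 8^-1 / p * s.
  by rewrite /s; field; rewrite gt_eqF.
rewrite -[8^-1 / p * t `^ p * _]mulrA -/s opprD expRD mulrA mulrAC [leRHS]mulrC.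
rewrite ler_wpM2r ?expR_ge0// expRN ler_pdivrMr ?expR_gt0//.
apply: (le_trans (HK n n0)); rewrite mulrC ler_wpM2l ?(ltW V0)//.
by rewrite (le_trans Kn)// ler_expR ler_wpM2l// ltW.
Unshelve. all: by end_near. Qed.

(** The hypothesis on [n] makes the factor [8 p n] negligible; the dimension
    is written [n.+1] to single out the first coordinate. *)
Lemma lower_tail_of_large {R : realType} (p q : R) (n : nat) : 1 <= p -> p < q ->
  8 * p * n.+1%:R <= expR (p^-1 * n.+1%:R `^ (p / q)) ->
  lower_tail p q (5 / p) n.+1.
Proof.
move=> p1 pq pn t t2 tn; have p0 : 0 < p by rewrite (lt_le_trans _ p1).
have q0 : 0 < q by exact: lt_trans pq.
have c0 : 0 < p^-1 by rewrite invr_gt0.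
have t0 : 0 < t by rewrite (lt_le_trans _ t2).
have t1 : 1 <= t by rewrite (le_trans _ t2)// ler1n.
rewrite nu_tailE ?(ltW t0)//.
have V0 := ball_volume_gt0 p1 (ltn0Sn n).
set V := fine _ in V0 *.
have nR : 0 < n.+1%:R :> R by rewrite ltr0n.
have n1 : 1 <= n.+1%:R :> R by rewrite ler1n.
pose a := t * n.+1%:R `^ q^-1.
have nq1 : 1 <= n.+1%:R `^ q^-1 :> R.
  by rewrite -[leLHS](powRr0 n.+1%:R) ler_powR// invr_ge0 ltW.
have a1 : 1 <= a by rewrite (le_trans t1)// ler_peMr// ltW.
have a0 : 0 < a by rewrite (lt_le_trans _ a1).
have aq : a `^ q = n.+1%:R * t `^ q.
  by rewrite /a powRM ?powR_ge0 ?(ltW t0)// -powRrM mulVf ?gt_eqF// powRr1 1?mulrC// ltW.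
set s := t `^ p * n.+1%:R `^ (p / q).
have ap : a `^ p = s.
  by rewrite /a /s powRM ?powR_ge0 ?(ltW t0)// -powRrM [q^-1 * p]mulrC.
have an : a `^ p <= n.+1%:R / 2.
  have : a <= 2^-1 * n.+1%:R `^ p^-1.
    rewrite /a -ler_pdivlMr ?powR_gt0// (le_trans tn)// -mulrA.
    by rewrite powRB ?lexx//; apply/implyP => _; rewrite gt_eqF.
  move=> /(ge0_ler_powR (ltW p0)); rewrite !nnegrE (ltW a0).
  rewrite mulr_ge0 ?powR_ge0 ?invr_ge0// => /(_ isT isT) /le_trans; apply.
  rewrite powRM ?powR_ge0 ?invr_ge0// -powRrM mulVf ?gt_eqF// powRr1 ?(ltW nR)//.
  rewrite mulrC ler_wpM2l ?(ltW nR)//.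
  by apply: ge1r_powR => //; rewrite invr_gt0 ltr0n/= invf_le1// ler1n.
apply: (@le_trans _ _ ((((8 * p * n.+1%:R)^-1 * expR (- (4 / p * a `^ p)) * V)%:E *
    (V^-1)%:E)%E)).
  rewrite -EFinM lee_fin mulfK ?gt_eqF// ap -[5 / p * t `^ p * _]mulrA -/s.
  have ns : n.+1%:R `^ (p / q) <= s.
    by rewrite ler_peMl ?powR_ge0// -[leLHS](powRr0 t) ler_powR// ltW.
  have -> : 5 / p * s = 4 / p * s + p^-1 * s by ring.
  rewrite opprD expRD mulrC ler_wpM2r ?expR_ge0// expRN lef_pV2 ?posrE ?expR_gt0 ?mulr_gt0//.
  by rewrite (le_trans pn)// ler_expR ler_wpM2l// ltW.
apply: lee_wpmul2r; first by rewrite lee_fin invr_ge0 ltW.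
apply: (le_trans (first_coordinate_tail_ge p1 a1 an)).
apply: le_measure; rewrite ?inE.
- exact: measurable_ball_first_coordinate.
- exact: measurable_ball_Lq_tail.
move=> u /= [-> au]; split => //; rewrite -aq.
apply: (@lt_le_trans _ _ (`|tnth u ord0| `^ q)).
  apply: gt0_ltr_powR; rewrite ?nnegrE// ?(ltW a0)//.
  by rewrite (lt_le_trans au)// ler_norm.
by rewrite /power_sum big_ord_recl lerDl sumr_ge0// => i _; exact: powR_ge0.
Qed.

Lemma lower_tail_eventually {R : realType} (p q : R) : 1 <= p -> p < q ->
  \forall n \near \oo, lower_tail p q (5 / p) n.
Proof.
move=> p1 pq; have p0 : 0 < p by rewrite (lt_le_trans _ p1).
have c0 : 0 < p^-1 by rewrite invr_gt0.
have pq0 : 0 < p / q by rewrite divr_gt0// (lt_trans p0).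
near=> n.
have n0 : (0 < n)%N by near: n; exact: nbhs_infty_gt.
rewrite -(prednK n0); apply: lower_tail_of_large => //; rewrite prednK//.
by near: n; exact: linear_le_exp_powR.
Unshelve. all: by end_near. Qed.

Lemma universal_T_eventually {R : realType} (tau p q : R) :
  \forall n \near \oo, universal_T tau p q n = tau * q `^ p^-1.
Proof.
near=> n; rewrite /universal_T min_l//.
have qn : expR q <= n%:R by near: n; exact: nbhs_infty_ger.
by rewrite -[leLHS]expRK ler_ln ?posrE ?expR_gt0// (lt_le_trans (expR_gt0 q)).
Unshelve. all: by end_near. Qed.

Lemma tails_eventually {R : realType} (p q : R) : 1 <= p -> p < q ->
  \forall n \near \oo,
    [/\ upper_tail p q (8^-1 / p) (universal_T 32 p q n) n,
        lower_tail p q (5 / p) n &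
        universal_T 32 p q n <= 32 * q `^ p^-1].
Proof.
move=> p1 pq; near=> n.
have -> : universal_T 32 p q n = 32 * q `^ p^-1.
  by near: n; exact: universal_T_eventually.
split; last by [].
- by near: n; exact: upper_tail_eventually.
- by near: n; exact: lower_tail_eventually.
Unshelve. all: by end_near. Qed.

Theorem corollary4 (R : realType) :
  [/\ (forall p q : R, 1 <= p -> p < q ->
         exists c C T : R, [/\ 0 < c, 0 < C, 0 < T &
           \forall n \near \oo, upper_tail p q c T n /\ lower_tail p q C n]),
      (exists gamma Gamma tau : R, [/\ 0 < gamma, 0 < Gamma, 0 < tau &
         forall p q : R, 1 <= p -> p < q -> 2 * p < q ->
           \forall n \near \oo,
             [/\ upper_tail p q (gamma / p) (universal_T tau p q n) n,
                 lower_tail p q (Gamma / p) n &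
                 universal_T tau p q n <= tau * q `^ p^-1]])
    & (forall lambda : R, 1 < lambda ->
         exists gamma Gamma tau : R, [/\ 0 < gamma, 0 < Gamma, 0 < tau &
           forall p q : R, 1 <= p -> p < q -> lambda * p < q ->
             \forall n \near \oo,
               [/\ upper_tail p q (gamma / p) (universal_T tau p q n) n,
                   lower_tail p q (Gamma / p) n &
                   universal_T tau p q n <= tau * q `^ p^-1]])].
Proof.
split.
- move=> p q p1 pq; have p0 : 0 < p by rewrite (lt_le_trans _ p1).
  exists (8^-1 / p), (5 / p), (32 * q `^ p^-1); split.
  + by rewrite divr_gt0.
  + by rewrite divr_gt0.
  + by rewrite mulr_gt0// powR_gt0// (lt_trans p0).
  near=> n; split.
  + by near: n; exact: upper_tail_eventually.
  + by near: n; exact: lower_tail_eventually.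
- by exists 8^-1, 5, 32; split=> // p q p1 pq _; exact: tails_eventually.
- move=> lambda _.
  by exists 8^-1, 5, 32; split=> // p q p1 pq _; exact: tails_eventually.
Unshelve. all: by end_near. Qed.
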